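(* Let $S,T$ be as in the context and let $\mathrm{Pr}_T(x)$ be any $\Sigma_1$ provability predicate of $T$. Then: 1. If $\mathrm{Pr}_T(x)$ satisfies $\mathbf{E}$ and $\mathbf{D3}$, then $T\nvdash\mathrm{Con}^{\mathrm{S}}_T$. 2. If $\mathrm{Pr}_T(x)$ satisfies $\mathbf{\Sigma_1C}^-$, then $T\nvdash\mathrm{Con}^{\mathrm{S}}_T$.
   Context: $\mathcal{L}_A=\{0,\mathsf{s},+,\times,\leq\}$ is the language of first-order arithmetic, and ''formula'' means $\mathcal{L}_A$-formula; $\ulcorner\varphi\urcorner$ is the numeral of the Gödel number of $\varphi$. $\Sigma_1$ formulas are those of the form $\exists\vec{x}\,\delta$ with $\delta$ a $\Delta_0$ formula. $S$ and $T$ are consistent c.e. extensions of Peano Arithmetic $\mathsf{PA}$ in the language $\mathcal{L}_A$ such that $T$ is stronger than $S$ (every theorem of $S$ is a theorem of $T$; $S=T$ is allowed). A formula $\mathrm{Pr}_T(x)$ is a provability predicate of $T$ if for every formula $\varphi$: $T\vdash\varphi$ if and only if $S\vdash\mathrm{Pr}_T(\ulcorner\varphi\urcorner)$. A $\Sigma_1$ provability predicate is one that is a $\Sigma_1$ formula. $\mathrm{Con}^{\mathrm{S}}_T := \{\mathrm{Pr}_T(\ulcorner\varphi\urcorner)\to\neg\,\mathrm{Pr}_T(\ulcorner\neg\varphi\urcorner)\mid \varphi \text{ a formula}\}$; $T\nvdash\mathrm{Con}^{\mathrm{S}}_T$ means that $T$ fails to prove at least one member of this set. Conditions on $\mathrm{Pr}_T(x)$: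 - $\mathbf{E}$: for all formulas $\varphi,\psi$, if $T\vdash\varphi\leftrightarrow\psi$, then $S\vdash\mathrm{Pr}_T(\ulcorner\varphi\urcorner)\leftrightarrow\mathrm{Pr}_T(\ulcorner\psi\urcorner)$. - $\mathbf{D3}$: $S\vdash\mathrm{Pr}_T(\ulcorner\varphi\urcorner)\to\mathrm{Pr}_T(\ulcorner\mathrm{Pr}_T(\ulcorner\varphi\urcorner)\urcorner)$ for every formula $\varphi$. - $\mathbf{\Sigma_1C}^-$: there is a finite subtheory $T_0$ of $T$ (a finite set of sentences that are theorems of $T$) such that for every $\Sigma_1$ sentence $\varphi$, $S\vdash\varphi\to\mathrm{Pr}_T(\ulcorner\bigwedge T_0\to\varphi\urcorner)$; by convention $\bigwedge\emptyset$ is $0=0$. *)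

(* Defs.v *)
From HB Require Import structures.
From mathcomp Require Import all_boot zify.

Set Implicit Arguments.
Unset Strict Implicit.
Unset Printing Implicit Defensive.

(** * Syntax of first-order arithmetic (de Bruijn indices) *)

Inductive term :=
| Var of nat
| Zero
| Succ of term
| Add of term & term
| Mul of term & term.

Inductive form :=
| Eq of term & term
| Le of term & term
| Bot
| Imp of form & form
| And of form & form
| Or of form & form
| All of form
| Ex of form.

Definition Neg (phi : form) : form := Imp phi Bot.
Definition Iff (phi psi : form) : form := And (Imp phi psi) (Imp psi phi).

Fixpoint substt (sigma : nat -> term) (t : term) : term :=
  match t with
  | Var i => sigma i
  | Zero => Zero
  | Succ t => Succ (substt sigma t)
  | Add t u => Add (substt sigma t) (substt sigma u)
  | Mul t u => Mul (substt sigma t) (substt sigma u)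
  end.

Definition shiftt : term -> term := substt (fun i => Var i.+1).

Definition scons (t : term) (sigma : nat -> term) : nat -> term :=
  fun i => if i is j.+1 then sigma j else t.

Definition up (sigma : nat -> term) : nat -> term :=
  scons (Var 0) (fun i => shiftt (sigma i)).

Fixpoint substf (sigma : nat -> term) (phi : form) : form :=
  match phi with
  | Eq t u => Eq (substt sigma t) (substt sigma u)
  | Le t u => Le (substt sigma t) (substt sigma u)
  | Bot => Bot
  | Imp phi psi => Imp (substf sigma phi) (substf sigma psi)
  | And phi psi => And (substf sigma phi) (substf sigma psi)
  | Or phi psi => Or (substf sigma phi) (substf sigma psi)
  | All phi => All (substf (up sigma) phi)
  | Ex phi => Ex (substf (up sigma) phi)
  end.

Definition shiftf : form -> form := substf (fun i => Var i.+1).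

(* [t] replaces index 0 and the other free indices go down by one. *)
Definition inst (t : term) : form -> form := substf (scons t Var).

Fixpoint closedt (k : nat) (t : term) : bool :=
  match t with
  | Var i => i < k
  | Zero => true
  | Succ t => closedt k t
  | Add t u | Mul t u => closedt k t && closedt k u
  end.

(* Every free index of [phi] is less than [k]. *)
Fixpoint closedf (k : nat) (phi : form) : bool :=
  match phi with
  | Eq t u | Le t u => closedt k t && closedt k u
  | Bot => true
  | Imp phi psi | And phi psi | Or phi psi => closedf k phi && closedf k psi
  | All phi | Ex phi => closedf k.+1 phi
  end.

Definition sentence (phi : form) : bool := closedf 0 phi.

(** * Arithmetical hierarchy *)

Inductive Delta0 : form -> Prop :=
| Delta0_Eq t u : Delta0 (Eq t u)
| Delta0_Le t u : Delta0 (Le t u)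
| Delta0_Bot : Delta0 Bot
| Delta0_Imp phi psi : Delta0 phi -> Delta0 psi -> Delta0 (Imp phi psi)
| Delta0_And phi psi : Delta0 phi -> Delta0 psi -> Delta0 (And phi psi)
| Delta0_Or phi psi : Delta0 phi -> Delta0 psi -> Delta0 (Or phi psi)
| Delta0_All t phi :
    Delta0 phi -> Delta0 (All (Imp (Le (Var 0) (shiftt t)) phi))
| Delta0_Ex t phi :
    Delta0 phi -> Delta0 (Ex (And (Le (Var 0) (shiftt t)) phi)).

Definition Sigma1 (phi : form) : Prop :=
  exists (n : nat) (delta : form), Delta0 delta /\ phi = iter n Ex delta.

(** * Theories and provability *)

Definition theory := form -> Prop.

(* Classical natural deduction with equality.  The quantifier rules shift the
   local assumptions [G] but not the axioms in [T], which are sentences. *)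
Inductive prv (T : theory) : seq form -> form -> Prop :=
| prv_axiom G phi : T phi -> prv T G phi
| prv_hyp G phi : List.In phi G -> prv T G phi
| prv_ImpI G phi psi : prv T (phi :: G) psi -> prv T G (Imp phi psi)
| prv_ImpE G phi psi : prv T G (Imp phi psi) -> prv T G phi -> prv T G psi
| prv_AndI G phi psi : prv T G phi -> prv T G psi -> prv T G (And phi psi)
| prv_AndE1 G phi psi : prv T G (And phi psi) -> prv T G phi
| prv_AndE2 G phi psi : prv T G (And phi psi) -> prv T G psi
| prv_OrI1 G phi psi : prv T G phi -> prv T G (Or phi psi)
| prv_OrI2 G phi psi : prv T G psi -> prv T G (Or phi psi)
| prv_OrE G phi psi chi :
    prv T G (Or phi psi) -> prv T (phi :: G) chi -> prv T (psi :: G) chi ->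
    prv T G chi
| prv_AllI G phi : prv T (map shiftf G) phi -> prv T G (All phi)
| prv_AllE G phi t : prv T G (All phi) -> prv T G (inst t phi)
| prv_ExI G phi t : prv T G (inst t phi) -> prv T G (Ex phi)
| prv_ExE G phi chi :
    prv T G (Ex phi) -> prv T (phi :: map shiftf G) (shiftf chi) ->
    prv T G chi
| prv_EqI G t : prv T G (Eq t t)
| prv_EqE G t u phi :
    prv T G (Eq t u) -> prv T G (inst t phi) -> prv T G (inst u phi)
| prv_RAA G phi : prv T (Neg phi :: G) Bot -> prv T G phi.

Definition provable (T : theory) (phi : form) : Prop := prv T [::] phi.

Definition consistent (T : theory) : Prop := ~ provable T Bot.

Definition stronger (T S : theory) : Prop :=
  forall phi, provable S phi -> provable T phi.

(** * Peano Arithmetic *)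

Definition induction_formula (phi : form) : form :=
  Imp (And (inst Zero phi)
           (All (Imp phi (substf (scons (Succ (Var 0)) (fun i => Var i.+1)) phi))))
      (All phi).

Inductive PA : theory :=
| PA_Succ_neq0 : PA (All (Neg (Eq Zero (Succ (Var 0)))))
| PA_Succ_inj :
    PA (All (All (Imp (Eq (Succ (Var 1)) (Succ (Var 0))) (Eq (Var 1) (Var 0)))))
| PA_Add_0 : PA (All (Eq (Add (Var 0) Zero) (Var 0)))
| PA_Add_Succ :
    PA (All (All (Eq (Add (Var 1) (Succ (Var 0))) (Succ (Add (Var 1) (Var 0))))))
| PA_Mul_0 : PA (All (Eq (Mul (Var 0) Zero) Zero))
| PA_Mul_Succ :
    PA (All (All (Eq (Mul (Var 1) (Succ (Var 0)))
                     (Add (Mul (Var 1) (Var 0)) (Var 1)))))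
| PA_Le :
    PA (All (All (Iff (Le (Var 1) (Var 0))
                      (Ex (Eq (Add (Var 2) (Var 0)) (Var 1))))))
| PA_induction (phi : form) (n : nat) :
    sentence (iter n All (induction_formula phi)) ->
    PA (iter n All (induction_formula phi)).

(** * Goedel numbering *)

(* Shoenfield's ordered pair; it is injective. *)
Definition opair (a b : nat) : nat := ((a + b) * (a + b) + a).+1.

Fixpoint gnt (t : term) : nat :=
  match t with
  | Var i => opair 0 i
  | Zero => opair 1 0
  | Succ t => opair 2 (gnt t)
  | Add t u => opair 3 (opair (gnt t) (gnt u))
  | Mul t u => opair 4 (opair (gnt t) (gnt u))
  end.

Fixpoint gn (phi : form) : nat :=
  match phi with
  | Eq t u => opair 5 (opair (gnt t) (gnt u))
  | Le t u => opair 6 (opair (gnt t) (gnt u))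
  | Bot => opair 7 0
  | Imp phi psi => opair 8 (opair (gn phi) (gn psi))
  | And phi psi => opair 9 (opair (gn phi) (gn psi))
  | Or phi psi => opair 10 (opair (gn phi) (gn psi))
  | All phi => opair 11 (gn phi)
  | Ex phi => opair 12 (gn phi)
  end.

Lemma opair_inj a b c d : opair a b = opair c d -> a = c /\ b = d.
Proof.
rewrite /opair => -[E].
have Es : a + b = c + d.
  case: (ltngtP (a + b) (c + d)) => // H.
  - have := leq_mul H H; nia.
  - have := leq_mul H H; nia.
move: E; rewrite Es; lia.
Qed.

Lemma gnt_inj : injective gnt.
Proof.
elim=> [i||t IHt|t IHt u IHu|t IHt u IHu] [j||t'|t' u'|t' u'] //=
  => /opair_inj [] // _.
- by move=> ->.
- by move=> /IHt ->.
- by move=> /opair_inj [/IHt -> /IHu ->].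
- by move=> /opair_inj [/IHt -> /IHu ->].
Qed.

Lemma gn_inj : injective gn.
Proof.
elim=> [t u|t u||p IHp q IHq|p IHp q IHq|p IHp q IHq|p IHp|p IHp]
  [t' u'|t' u'||p' q'|p' q'|p' q'|p'|p'] //= => /opair_inj [] // _.
- by move=> /opair_inj [/gnt_inj -> /gnt_inj ->].
- by move=> /opair_inj [/gnt_inj -> /gnt_inj ->].
- by move=> /opair_inj [/IHp -> /IHq ->].
- by move=> /opair_inj [/IHp -> /IHq ->].
- by move=> /opair_inj [/IHp -> /IHq ->].
- by move=> /IHp ->.
- by move=> /IHp ->.
Qed.

HB.instance Definition _ := Equality.copy form (inj_type gn_inj).

Definition numeral (n : nat) : term := iter n Succ Zero.

Definition quote (phi : form) : term := numeral (gn phi).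

(** * Computably enumerable theories *)

(* [mu_rec n]: descriptions of partial recursive functions of [n] arguments. *)
Inductive mu_rec : nat -> Type :=
| mu_zero n : mu_rec n
| mu_succ : mu_rec 1
| mu_proj n : 'I_n -> mu_rec n
| mu_comp m n : mu_rec m -> ('I_m -> mu_rec n) -> mu_rec n
| mu_prim n : mu_rec n -> mu_rec n.+2 -> mu_rec n.+1
| mu_min n : mu_rec n.+1 -> mu_rec n.

(* [mu_eval f v y]: the computation of [f] on [v] converges to [y]. *)
Fixpoint mu_eval n (f : mu_rec n) : n.-tuple nat -> nat -> Prop :=
  match f with
  | mu_zero _ => fun _ y => y = 0
  | mu_succ => fun v y => y = (tnth v ord0).+1
  | mu_proj _ i => fun v y => y = tnth v i
  | mu_comp m _ g h => fun v y =>
      exists w : m.-tuple nat,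
        (forall i, mu_eval (h i) v (tnth w i)) /\ mu_eval g w y
  | mu_prim _ g h => fun v y =>
      let xs := [tuple of behead v] in
      exists s : nat -> nat,
        [/\ mu_eval g xs (s 0),
            forall i, i < tnth v ord0 ->
              mu_eval h [tuple of i :: s i :: xs] (s i.+1)
          & y = s (tnth v ord0)]
  | mu_min _ g => fun v y =>
      mu_eval g [tuple of y :: v] 0 /\
      (forall z, z < y -> exists w, mu_eval g [tuple of z :: v] w.+1)
  end.

Definition ce_set (A : nat -> Prop) : Prop :=
  exists f : mu_rec 1, forall n, A n <-> exists y, mu_eval f [tuple n] y.

Definition ce_theory (T : theory) : Prop :=
  (forall phi, T phi -> sentence phi) /\
  ce_set (fun n => exists phi, T phi /\ gn phi = n).

(** * Provability predicates *)

(* The variable [x] of [Pr(x)] is index 0. *)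
Definition provability_predicate (S T : theory) (Pr : form) : Prop :=
  closedf 1 Pr /\
  forall phi, provable T phi <-> provable S (inst (quote phi) Pr).

Definition Con_S (Pr : form) : theory := fun chi =>
  exists phi, chi = Imp (inst (quote phi) Pr) (Neg (inst (quote (Neg phi)) Pr)).

Definition cond_E (S T : theory) (Pr : form) : Prop :=
  forall phi psi, provable T (Iff phi psi) ->
    provable S (Iff (inst (quote phi) Pr) (inst (quote psi) Pr)).

Definition cond_D3 (S : theory) (Pr : form) : Prop :=
  forall phi, provable S (Imp (inst (quote phi) Pr)
                              (inst (quote (inst (quote phi) Pr)) Pr)).

Fixpoint bigAnd (s : seq form) : form :=
  match s with
  | [::] => Eq Zero Zero
  | [:: phi] => phi
  | phi :: s => And phi (bigAnd s)
  end.

Definition cond_Sigma1C_minus (S T : theory) (Pr : form) : Prop :=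
  exists T0 : seq form,
    [/\ uniq T0,
        forall psi, psi \in T0 -> sentence psi /\ provable T psi
      & forall phi, sentence phi -> Sigma1 phi ->
          provable S (Imp phi (inst (quote (Imp (bigAnd T0) phi)) Pr))].

(* Main.v *)
From mathcomp Require Import all_boot zify.
Require Import Defs.

Set Implicit Arguments.
Unset Strict Implicit.
Unset Printing Implicit Defensive.

(** Let [theta] be a Sigma1 fixed point of [Pr(~psi)], where [psi] is [theta]
    itself (part 1) or [/\ T0 -> theta] (part 2).  In both cases
    [Pr(~psi) -> Pr(psi)] is provable: by D3 followed by E along
    [theta <-> Pr(~theta)] in part 1, by Sigma1 completeness of [theta] in part 2.
    The instance of [Con_S] at [psi] then refutes [theta]; hence [~psi] is a
    theorem, so is [Pr(~psi)], and so is [theta].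

    The diagonal lemma has to give a literally Sigma1 sentence.  Substitution is
    never represented: [theta] is [exists x y z v, x = d /\ alpha], so its code is
    a polynomial in [d = gn alpha] and the code of the numeral [d].  The graph of
    [d |-> gnt (numeral d)] is only defined correctly in the standard model, with
    Goedel's beta function; a Rosser-style uniqueness clause together with Delta0
    completeness makes it provably single-valued at each numeral. *)

Arguments numeral : simpl never.

(** * Substitution *)

Lemma substt_ext sigma tau t : sigma =1 tau -> substt sigma t = substt tau t.
Proof. by move=> E; elim: t => //= [t ->|t -> u ->|t -> u ->]. Qed.

Lemma up_ext sigma tau : sigma =1 tau -> up sigma =1 up tau.
Proof. by move=> E [|i] //=; rewrite E. Qed.

Lemma substf_ext sigma tau phi :
  sigma =1 tau -> substf sigma phi = substf tau phi.
Proof.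
elim: phi sigma tau => //=.
- by move=> t u s s' E; rewrite !(substt_ext _ E).
- by move=> t u s s' E; rewrite !(substt_ext _ E).
- by move=> p IHp q IHq s s' E; rewrite (IHp _ _ E) (IHq _ _ E).
- by move=> p IHp q IHq s s' E; rewrite (IHp _ _ E) (IHq _ _ E).
- by move=> p IHp q IHq s s' E; rewrite (IHp _ _ E) (IHq _ _ E).
- by move=> p IHp s s' /up_ext E; rewrite (IHp _ _ E).
- by move=> p IHp s s' /up_ext E; rewrite (IHp _ _ E).
Qed.

Lemma substt_comp sigma tau t :
  substt sigma (substt tau t) = substt (fun i => substt sigma (tau i)) t.
Proof. by elim: t => //= [t ->|t -> u ->|t -> u ->]. Qed.

Lemma up_comp sigma tau :
  (fun i => substt (up sigma) (up tau i)) =1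
  up (fun i => substt sigma (tau i)).
Proof. by case=> [|i] //=; rewrite /shiftt !substt_comp. Qed.

Lemma substf_comp sigma tau phi :
  substf sigma (substf tau phi) = substf (fun i => substt sigma (tau i)) phi.
Proof.
elim: phi sigma tau => //=.
- by move=> t u s s'; rewrite !substt_comp.
- by move=> t u s s'; rewrite !substt_comp.
- by move=> p IHp q IHq s s'; rewrite IHp IHq.
- by move=> p IHp q IHq s s'; rewrite IHp IHq.
- by move=> p IHp q IHq s s'; rewrite IHp IHq.
- by move=> p IHp s s'; rewrite IHp (substf_ext _ (up_comp s s')).
- by move=> p IHp s s'; rewrite IHp (substf_ext _ (up_comp s s')).
Qed.

Lemma substt_closed k sigma tau t :
  closedt k t -> (forall i, i < k -> sigma i = tau i) ->
  substt sigma t = substt tau t.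
Proof.
move=> + E; elim: t => //= [t IH /IH-> //|t IHt u IHu|t IHt u IHu];
  by case/andP=> /IHt-> /IHu->.
Qed.

Lemma substf_closed k sigma tau phi :
  closedf k phi -> (forall i, i < k -> sigma i = tau i) ->
  substf sigma phi = substf tau phi.
Proof.
have upE j s s' : (forall i, i < j -> s i = s' i) ->
  forall i, i < j.+1 -> up s i = up s' i by move=> E [|i] //=; rewrite ltnS => /E ->.
elim: phi k sigma tau => //=.
- by move=> t u k s s' /andP[ct cu] E; rewrite !(substt_closed _ E).
- by move=> t u k s s' /andP[ct cu] E; rewrite !(substt_closed _ E).
- by move=> p IHp q IHq k s s' /andP[cp cq] E; rewrite (IHp k s s') ?(IHq k s s').
- by move=> p IHp q IHq k s s' /andP[cp cq] E; rewrite (IHp k s s') ?(IHq k s s').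
- by move=> p IHp q IHq k s s' /andP[cp cq] E; rewrite (IHp k s s') ?(IHq k s s').
- by move=> p IHp k s s' cp /upE E; rewrite (IHp _ _ _ cp E).
- by move=> p IHp k s s' cp /upE E; rewrite (IHp _ _ _ cp E).
Qed.

Lemma up_Var : up Var =1 Var.
Proof. by case. Qed.

Lemma substt_id t : substt Var t = t.
Proof. by elim: t => //= [t ->|t -> u ->|t -> u ->]. Qed.

Lemma substf_id phi : substf Var phi = phi.
Proof.
elim: phi => //= [t u|t u|p -> q ->|p -> q ->|p -> q ->|p IH|p IH] //;
  by rewrite ?substt_id // (substf_ext _ up_Var) IH.
Qed.

Lemma substf_sentence sigma phi : sentence phi -> substf sigma phi = phi.
Proof. by move=> c; rewrite -[RHS]substf_id; apply: substf_closed c _. Qed.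

Lemma substt_scons_shiftt t sigma u :
  substt (scons t sigma) (shiftt u) = substt sigma u.
Proof. by rewrite /shiftt substt_comp. Qed.

Lemma inst_substf t sigma phi :
  inst t (substf (up sigma) phi) = substf (scons t sigma) phi.
Proof.
rewrite /inst substf_comp; apply: substf_ext => -[|i] //=.
by rewrite substt_scons_shiftt substt_id.
Qed.

(** Once the context is shifted, the eigenvariable is index 0, and instantiating with it undoes the
    shift. This is how an eigenvariable becomes an existential witness. *)
Lemma inst_Var0_up phi : inst (Var 0) (substf (up (fun i => Var i.+1)) phi) = phi.
Proof. by rewrite inst_substf -[RHS]substf_id; apply: substf_ext => -[]. Qed.

Lemma substt_numeral sigma n : substt sigma (numeral n) = numeral n.
Proof. by elim: n => //= n IH; rewrite /numeral iterS /= -/(numeral n) IH. Qed.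

Lemma shiftt_numeral n : shiftt (numeral n) = numeral n.
Proof. exact: substt_numeral. Qed.

Lemma closedt_numeral k n : closedt k (numeral n).
Proof. by elim: n. Qed.

Lemma closedt_substt k l sigma t :
  closedt k t -> (forall i, i < k -> closedt l (sigma i)) ->
  closedt l (substt sigma t).
Proof.
move=> + E; elim: t => //= [t IHt u IHu|t IHt u IHu];
  by case/andP=> /IHt-> /IHu->.
Qed.

Lemma closedf_substf k l sigma phi :
  closedf k phi -> (forall i, i < k -> closedt l (sigma i)) ->
  closedf l (substf sigma phi).
Proof.
have upP j j' s : (forall i, i < j -> closedt j' (s i)) ->
  forall i, i < j.+1 -> closedt j'.+1 (up s i).
  by move=> E [|i] //=; rewrite ltnS => /E c; apply: closedt_substt c _.
elim: phi k l sigma => //=.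
- by move=> t u k l s /andP[ct cu] E; rewrite !(closedt_substt _ E).
- by move=> t u k l s /andP[ct cu] E; rewrite !(closedt_substt _ E).
- by move=> p IHp q IHq k l s /andP[cp cq] E; rewrite (IHp k) ?(IHq k).
- by move=> p IHp q IHq k l s /andP[cp cq] E; rewrite (IHp k) ?(IHq k).
- by move=> p IHp q IHq k l s /andP[cp cq] E; rewrite (IHp k) ?(IHq k).
- by move=> p IHp k l s cp /upP E; rewrite (IHp _ _ _ cp E).
- by move=> p IHp k l s cp /upP E; rewrite (IHp _ _ _ cp E).
Qed.

Lemma closedf_iter_Ex k n phi : closedf k (iter n Ex phi) = closedf (n + k) phi.
Proof. by elim: n k => //= n IH k; rewrite IH addnS. Qed.

Lemma closedf_iter_shiftf k n phi :
  closedf k phi -> closedf (n + k) (iter n shiftf phi).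
Proof.
by move=> c; elim: n => //= n IH; apply: closedf_substf IH _.
Qed.

Lemma substf_iter_Ex n sigma phi :
  substf sigma (iter n Ex phi) = iter n Ex (substf (iter n up sigma) phi).
Proof. by elim: n sigma => //= n IH s; rewrite IH -iterSr. Qed.

Lemma up_shiftt sigma t : substt (up sigma) (shiftt t) = shiftt (substt sigma t).
Proof. by rewrite /shiftt !substt_comp; apply: substt_ext. Qed.

Lemma Delta0_substf sigma phi : Delta0 phi -> Delta0 (substf sigma phi).
Proof.
move=> D; elim: D sigma => /= [t u|t u||p q _ IHp _ IHq|p q _ IHp _ IHq
  |p q _ IHp _ IHq|t p _ IH|t p _ IH] s; rewrite ?up_shiftt; by constructor.
Qed.

Lemma Sigma1_substf sigma phi : Sigma1 phi -> Sigma1 (substf sigma phi).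
Proof.
case=> n [d [Dd ->]]; exists n, (substf (iter n up sigma) d).
by split; [apply: Delta0_substf | rewrite substf_iter_Ex].
Qed.

(** * Derived rules *)

Lemma prv_weak T G G' phi :
  prv T G phi -> (forall x, List.In x G -> List.In x G') -> prv T G' phi.
Proof.
have consI H H' p : (forall x : form, List.In x H -> List.In x H') ->
  forall x, List.In x (p :: H) -> List.In x (p :: H').
  by move=> s x /= [->|/s]; auto.
have mapI H H' : (forall x : form, List.In x H -> List.In x H') ->
  forall x, List.In x (map shiftf H) -> List.In x (map shiftf H').
  by move=> s x /List.in_map_iff [y [<- /s Hy]]; apply: List.in_map.
move=> D; elim: D G' => {G phi}.
- by move=> *; apply: prv_axiom.
- by move=> *; apply: prv_hyp; auto.
- by move=> G p q _ IH G' s; apply: prv_ImpI; apply: IH; apply: consI.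
- by move=> G p q _ IH1 _ IH2 G' s; apply: prv_ImpE (IH1 _ s) (IH2 _ s).
- by move=> G p q _ IH1 _ IH2 G' s; apply: prv_AndI; auto.
- by move=> G p q _ IH G' s; apply: prv_AndE1 (IH _ s).
- by move=> G p q _ IH G' s; apply: prv_AndE2 (IH _ s).
- by move=> G p q _ IH G' s; apply: prv_OrI1; auto.
- by move=> G p q _ IH G' s; apply: prv_OrI2; auto.
- move=> G p q r _ IH1 _ IH2 _ IH3 G' s.
  by apply: prv_OrE (IH1 _ s) _ _; [apply: IH2 | apply: IH3]; apply: consI.
- by move=> G p _ IH G' s; apply: prv_AllI; apply: IH; apply: mapI.
- by move=> G p t _ IH G' s; apply: prv_AllE; auto.
- by move=> G p t _ IH G' s; apply: prv_ExI (IH _ s).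
- move=> G p q _ IH1 _ IH2 G' s; apply: prv_ExE (IH1 _ s) _.
  by apply: IH2; apply: consI; apply: mapI.
- by move=> *; apply: prv_EqI.
- by move=> G t u p _ IH1 _ IH2 G' s; apply: prv_EqE (IH1 _ s) (IH2 _ s).
- by move=> G p _ IH G' s; apply: prv_RAA; apply: IH; apply: consI.
Qed.

Lemma prv0_weak T G phi : provable T phi -> prv T G phi.
Proof. by move=> D; apply: prv_weak D _. Qed.

Lemma prv_cut T G phi psi : prv T G phi -> prv T (phi :: G) psi -> prv T G psi.
Proof. by move=> D1 D2; apply: prv_ImpE (prv_ImpI D2) D1. Qed.

Lemma prv_BotE T G phi : prv T G Bot -> prv T G phi.
Proof. by move=> D; apply: prv_RAA; apply: prv_weak D _ => x; right. Qed.

Lemma prv_AllE2 T G phi t u :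
  prv T G (All (All phi)) -> prv T G (substf (scons u (scons t Var)) phi).
Proof. by move=> /(prv_AllE t) /(prv_AllE u); rewrite inst_substf. Qed.

Lemma prv_hyp0 T G phi : prv T (phi :: G) phi.
Proof. by apply: prv_hyp; left. Qed.

Lemma prv_hypS T G phi psi : prv T G psi -> prv T (phi :: G) psi.
Proof. by move=> D; apply: prv_weak D _ => x; right. Qed.

Lemma prv_Eq_sym T G t u : prv T G (Eq t u) -> prv T G (Eq u t).
Proof.
move=> D.
(* Leibniz's rule for the formula [x = t]: index 0 marks the place to rewrite, and the shift
   protects [t] from the instantiation. The congruences below use the same device. *)
have := prv_EqE (phi := Eq (Var 0) (shiftt t)) D.
by rewrite /inst /= !substt_scons_shiftt !substt_id; apply; apply: prv_EqI.
Qed.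

Lemma prv_Eq_trans T G t u v :
  prv T G (Eq t u) -> prv T G (Eq u v) -> prv T G (Eq t v).
Proof.
move=> D1 D2; have := prv_EqE (phi := Eq (shiftt t) (Var 0)) D2.
by rewrite /inst /= !substt_scons_shiftt !substt_id; apply.
Qed.

Lemma prv_Eq_substt T G t u v :
  prv T G (Eq t u) ->
  prv T G (Eq (substt (scons t Var) v) (substt (scons u Var) v)).
Proof.
move=> D.
have := prv_EqE (phi := Eq (shiftt (substt (scons t Var) v)) v) D.
by rewrite /inst /= !substt_scons_shiftt !substt_id; apply; apply: prv_EqI.
Qed.

Lemma prv_Eq_Succ T G t u :
  prv T G (Eq t u) -> prv T G (Eq (Succ t) (Succ u)).
Proof. exact: (@prv_Eq_substt _ _ _ _ (Succ (Var 0))). Qed.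

Lemma prv_Eq_Add T G t u t' u' :
  prv T G (Eq t t') -> prv T G (Eq u u') ->
  prv T G (Eq (Add t u) (Add t' u')).
Proof.
move=> /(@prv_Eq_substt _ _ _ _ (Add (Var 0) (shiftt u))).
move=> + /(@prv_Eq_substt _ _ _ _ (Add (shiftt t') (Var 0))).
rewrite /= !substt_scons_shiftt !substt_id; exact: prv_Eq_trans.
Qed.

Lemma prv_Eq_Mul T G t u t' u' :
  prv T G (Eq t t') -> prv T G (Eq u u') ->
  prv T G (Eq (Mul t u) (Mul t' u')).
Proof.
move=> /(@prv_Eq_substt _ _ _ _ (Mul (Var 0) (shiftt u))).
move=> + /(@prv_Eq_substt _ _ _ _ (Mul (shiftt t') (Var 0))).
rewrite /= !substt_scons_shiftt !substt_id; exact: prv_Eq_trans.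
Qed.

Lemma prv_Eq_Le T G t u t' u' :
  prv T G (Eq t t') -> prv T G (Eq u u') ->
  prv T G (Le t u) -> prv T G (Le t' u').
Proof.
move=> E1 E2 D.
have := prv_EqE (phi := Le (Var 0) (shiftt u)) E1.
rewrite /inst /= !substt_scons_shiftt !substt_id => /(_ D) D'.
have := prv_EqE (phi := Le (shiftt t') (Var 0)) E2.
by rewrite /inst /= !substt_scons_shiftt !substt_id; apply.
Qed.

Lemma prv_Ex_mono T G phi psi :
  prv T G (Ex phi) -> prv T (phi :: map shiftf G) psi -> prv T G (Ex psi).
Proof.
move=> D1 D2; apply: prv_ExE D1 _ => /=.
by apply: (prv_ExI (t := Var 0)); rewrite inst_Var0_up.
Qed.

(** A Sigma1 formula is literally prenex with a block of arbitrary length; this lemma and the next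
    carry a conjunct out of such a block and back in. *)
Lemma prv_iter_Ex_And T n phi psi G :
  prv T G (iter n Ex (And (iter n shiftf phi) psi)) ->
  prv T G (And phi (iter n Ex psi)).
Proof.
elim: n phi G => //= n IH phi G D; apply: prv_ExE D _ => /=.
rewrite -iterS iterSr -/(shiftf phi).
set X := iter n Ex _.
have /IH D : prv T (X :: map shiftf G) X by apply: prv_hyp; left.
apply: prv_AndI; first exact: prv_AndE1 D.
by apply: (prv_ExI (t := Var 0)); rewrite inst_Var0_up; apply: prv_AndE2 D.
Qed.

Lemma prv_And_iter_Ex T n phi psi G :
  List.In phi G -> prv T G (iter n Ex psi) ->
  prv T G (iter n Ex (And (iter n shiftf phi) psi)).
Proof.
elim: n phi G => /= [|n IH] phi G Gphi D.
  by apply: prv_AndI => //; apply: prv_hyp.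
apply: (prv_Ex_mono D); rewrite -iterS iterSr.
apply: IH; last by apply: prv_hyp; left.
by right; apply: List.in_map.
Qed.

(** * Arithmetic of numerals in PA *)

Lemma PA_Add0 G t : prv PA G (Eq (Add t Zero) t).
Proof. exact: prv_AllE (prv_axiom _ PA_Add_0). Qed.

Lemma PA_AddS G t u : prv PA G (Eq (Add t (Succ u)) (Succ (Add t u))).
Proof.
exact: (prv_AllE2 t u (prv_axiom G PA_Add_Succ)).
Qed.

Lemma PA_Mul0 G t : prv PA G (Eq (Mul t Zero) Zero).
Proof. exact: prv_AllE (prv_axiom _ PA_Mul_0). Qed.

Lemma PA_MulS G t u : prv PA G (Eq (Mul t (Succ u)) (Add (Mul t u) t)).
Proof.
exact: (prv_AllE2 t u (prv_axiom G PA_Mul_Succ)).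
Qed.

Lemma PA_SuccI G t u : prv PA G (Eq (Succ t) (Succ u)) -> prv PA G (Eq t u).
Proof.
apply: prv_ImpE.
exact: (prv_AllE2 t u (prv_axiom G PA_Succ_inj)).
Qed.

Lemma PA_Succ_neq G t : prv PA G (Eq Zero (Succ t)) -> prv PA G Bot.
Proof. by apply: prv_ImpE; apply: (prv_AllE t (prv_axiom G PA_Succ_neq0)). Qed.

Lemma PA_Le_Iff G t u :
  prv PA G (Iff (Le t u) (Ex (Eq (Add (shiftt t) (Var 0)) (shiftt u)))).
Proof.
exact: (prv_AllE2 t u (prv_axiom G PA_Le)).
Qed.

Lemma PA_LeI G t u v : prv PA G (Eq (Add t v) u) -> prv PA G (Le t u).
Proof.
move=> D; apply: prv_ImpE (prv_AndE2 (PA_Le_Iff _ _ _)) _.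
by apply: (prv_ExI (t := v)); rewrite /inst /= !substt_scons_shiftt !substt_id.
Qed.

Lemma PA_LeE G t u chi :
  prv PA G (Le t u) ->
  prv PA (Eq (Add (shiftt t) (Var 0)) (shiftt u) :: map shiftf G) (shiftf chi) ->
  prv PA G chi.
Proof. by move=> /(prv_ImpE (prv_AndE1 (PA_Le_Iff _ _ _))); apply: prv_ExE. Qed.

Lemma PA_ind phi :
  closedf 1 phi -> provable PA (inst Zero phi) ->
  prv PA [:: phi] (substf (scons (Succ (Var 0)) (fun i => Var i.+1)) phi) ->
  provable PA (All phi).
Proof.
move=> c D0 DS.
(* As [phi] has no parameters, the induction axiom is taken with an empty block of outer
   quantifiers. *)
have sent : sentence (iter 0 All (induction_formula phi)).
  rewrite /sentence /= c !andbT; apply/andP; split.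
    by apply: closedf_substf c _ => -[].
  by apply: closedf_substf c _ => -[].
apply: (prv_ImpE (prv_axiom _ (PA_induction sent))).
by apply: prv_AndI => //; apply: prv_AllI; apply: prv_ImpI.
Qed.

Lemma numeralS n : numeral n.+1 = Succ (numeral n).
Proof. by []. Qed.

Lemma PA_Add_numeral G m n :
  prv PA G (Eq (Add (numeral m) (numeral n)) (numeral (m + n))).
Proof.
elim: n => [|n IH]; first by rewrite addn0; apply: PA_Add0.
by rewrite addnS !numeralS; apply: prv_Eq_trans (PA_AddS _ _ _) (prv_Eq_Succ IH).
Qed.

Lemma PA_Mul_numeral G m n :
  prv PA G (Eq (Mul (numeral m) (numeral n)) (numeral (m * n))).
Proof.
elim: n => [|n IH]; first by rewrite muln0; apply: PA_Mul0.
rewrite mulnS addnC numeralS; apply: prv_Eq_trans (PA_MulS _ _ _) _.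
apply: prv_Eq_trans (PA_Add_numeral _ _ _); apply: prv_Eq_Add IH _.
exact: prv_EqI.
Qed.

Lemma PA_Le_numeral G m n : m <= n -> prv PA G (Le (numeral m) (numeral n)).
Proof.
by move=> /subnKC <-; apply: PA_LeI; apply: PA_Add_numeral.
Qed.

Lemma PA_numeral_neq G m n :
  m != n -> prv PA G (Eq (numeral m) (numeral n)) -> prv PA G Bot.
Proof.
elim: m n => [|m IH] [|n] // neq; rewrite ?numeralS.
- exact: PA_Succ_neq.
- by move=> /prv_Eq_sym; apply: PA_Succ_neq.
- by move=> /PA_SuccI; apply: IH.
Qed.

Fixpoint eq_upto (t : term) (m : nat) : form :=
  if m is k.+1 then Or (Eq t (numeral m)) (eq_upto t k) else Eq t (numeral 0).

Lemma substf_eq_upto sigma t m :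
  substf sigma (eq_upto t m) = eq_upto (substt sigma t) m.
Proof. by elim: m => //= m ->; rewrite substt_numeral. Qed.

Lemma prv_eq_uptoE T G t m chi :
  prv T G (eq_upto t m) ->
  (forall k, k <= m -> prv T (Eq t (numeral k) :: G) chi) -> prv T G chi.
Proof.
elim: m G => [|m IH] G D H /=; first by apply: prv_cut D (H 0 _).
apply: prv_OrE D (H _ _) _ => //.
apply: IH; first by apply: prv_hyp; left.
move=> k lekm; apply: prv_weak (H k (leqW lekm)) _ => x /= []; auto.
Qed.

Lemma PA_cases :
  provable PA (All (Or (Eq (Var 0) Zero) (Ex (Eq (Var 1) (Succ (Var 0)))))).
Proof.
apply: PA_ind => //; first by apply: prv_OrI1; apply: prv_EqI.
by apply: prv_OrI2; apply: (prv_ExI (t := Var 0)); apply: prv_EqI.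
Qed.

(** External induction on [m], with cases on [u] inside PA. If [u = 0] then [t] equals [m]. If [u]
    is the successor of [v], the successor of [t + v] equals [m]: absurd for [m = 0], and otherwise
    cancelling the successor leads to the previous bound. *)
Lemma PA_Add_eq_upto m G t u :
  prv PA G (Imp (Eq (Add t u) (numeral m)) (eq_upto t m)).
Proof.
elim: m G t u => [|m IH] G t u; apply: prv_ImpI.
all: apply: prv_OrE (prv_AllE u (prv0_weak _ PA_cases)) _ _.
all: rewrite -/(shiftt u) /=.
(* The two cases [u = 0]; only for a successor bound is the conclusion a disjunction. *)
1,3: try apply: prv_OrI1; apply: prv_Eq_trans (prv_hypS _ (prv_hyp0 _ _ _)).
1,2: apply: prv_Eq_trans (prv_Eq_sym (PA_Add0 _ _)) _.
1,2: by apply: prv_Eq_Add; [apply: prv_EqI | apply: prv_Eq_sym; apply: prv_hyp0].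
all: apply: prv_ExE (prv_hyp0 _ _ _) _ => /=; set E0 := Eq (substt _ u) _.
all: set G' := (E0 :: _).
all: have DS : prv PA G' (Eq (Succ (Add (shiftt t) (Var 0))) (Add (shiftt t) (shiftt u)))
       by apply: prv_Eq_trans (prv_Eq_sym (PA_AddS _ _ _)) _;
          apply: prv_Eq_Add; [apply: prv_EqI | apply: prv_Eq_sym; apply: prv_hyp0].
- apply: prv_BotE; apply: (@PA_Succ_neq _ (Add (shiftt t) (Var 0))).
  apply: prv_Eq_sym; apply: prv_Eq_trans DS _.
  by apply: prv_hyp; right; right; left.
- rewrite /shiftf /= substf_eq_upto; apply: prv_OrI2.
  apply: prv_ImpE (IH _ _ (Var 0)) _; apply: PA_SuccI.
  apply: prv_Eq_trans DS _.
  apply: prv_hyp; right; right; left.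
  by rewrite /shiftf /= substt_numeral.
Qed.

Lemma PA_Le_eq_upto m G t : prv PA G (Le t (numeral m)) -> prv PA G (eq_upto t m).
Proof.
move=> D; apply: PA_LeE D _; rewrite /shiftf substf_eq_upto.
apply: prv_ImpE (PA_Add_eq_upto _ _ _ (Var 0)) _.
by rewrite shiftt_numeral; apply: prv_hyp0.
Qed.

Lemma PA_Le_numeralE m G t chi :
  prv PA G (Le t (numeral m)) ->
  (forall k, k <= m -> prv PA (Eq t (numeral k) :: G) chi) -> prv PA G chi.
Proof. by move=> /PA_Le_eq_upto; apply: prv_eq_uptoE. Qed.

(** Induction inside PA on the variable [x], with [k] fixed outside. If [x <= k], then [x] is one of
    finitely many numerals, and comparing its successor with [k] is a matter of computation. *)
Lemma PA_Le_total_numeral k :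
  provable PA (All (Or (Le (numeral k) (Var 0)) (Le (Var 0) (numeral k)))).
Proof.
apply: PA_ind; rewrite /inst /= ?closedt_numeral // !substt_numeral.
  by apply: prv_OrI2; apply: (@PA_Le_numeral _ 0).
apply: prv_OrE (prv_hyp0 _ _ _) _ _.
  apply: prv_OrI1; apply: PA_LeE (prv_hyp0 _ _ _) _; rewrite /= shiftt_numeral.
  rewrite /shiftf /= substt_numeral.
  apply: (@PA_LeI _ _ _ (Succ (Var 0))); apply: prv_Eq_trans (PA_AddS _ _ _) _.
  by apply: prv_Eq_Succ; apply: prv_hyp0.
apply: PA_Le_numeralE (prv_hyp0 _ _ _) _ => j lejk.
have E : prv PA [:: Eq (Var 0) (numeral j); Le (Var 0) (numeral k);
    Or (Le (numeral k) (Var 0)) (Le (Var 0) (numeral k))]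
    (Eq (numeral j.+1) (Succ (Var 0))).
  by apply: prv_Eq_Succ; apply: prv_Eq_sym; apply: prv_hyp0.
have [ltjk|lekj] := ltnP j k.
  by apply: prv_OrI2; apply: prv_Eq_Le E (prv_EqI _ _ _) _; apply: PA_Le_numeral.
apply: prv_OrI1; apply: prv_Eq_Le (prv_EqI _ _ _) E _.
by apply: PA_Le_numeral; apply: leqW.
Qed.

(** * Delta0 completeness *)

Definition consn (a : nat) (rho : nat -> nat) : nat -> nat :=
  fun i => if i is j.+1 then rho j else a.

Fixpoint evalt (rho : nat -> nat) (t : term) : nat :=
  match t with
  | Var i => rho i
  | Zero => 0
  | Succ t => (evalt rho t).+1
  | Add t u => evalt rho t + evalt rho u
  | Mul t u => evalt rho t * evalt rho u
  end.

Fixpoint evalf (rho : nat -> nat) (phi : form) : Prop :=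
  match phi with
  | Eq t u => evalt rho t = evalt rho u
  | Le t u => evalt rho t <= evalt rho u
  | Bot => False
  | Imp phi psi => evalf rho phi -> evalf rho psi
  | And phi psi => evalf rho phi /\ evalf rho psi
  | Or phi psi => evalf rho phi \/ evalf rho psi
  | All phi => forall a, evalf (consn a rho) phi
  | Ex phi => exists a, evalf (consn a rho) phi
  end.

Definition nsub (rho : nat -> nat) : nat -> term := fun i => numeral (rho i).

Lemma evalt_substt rho sigma t :
  evalt rho (substt sigma t) = evalt (fun i => evalt rho (sigma i)) t.
Proof. by elim: t => //= [t ->|t -> u ->|t -> u ->]. Qed.

Lemma evalt_shiftt a rho t : evalt (consn a rho) (shiftt t) = evalt rho t.
Proof. by rewrite /shiftt evalt_substt /=. Qed.

Lemma evalt_numeral rho n : evalt rho (numeral n) = n.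
Proof. by elim: n => //= n IH; rewrite /= -/(numeral n) IH. Qed.

Lemma PA_evalt G rho t :
  prv PA G (Eq (substt (nsub rho) t) (numeral (evalt rho t))).
Proof.
elim: t => [i||t IH|t IHt u IHu|t IHt u IHu] /=; try exact: prv_EqI.
- exact: prv_Eq_Succ.
- exact: prv_Eq_trans (prv_Eq_Add IHt IHu) (PA_Add_numeral _ _ _).
- exact: prv_Eq_trans (prv_Eq_Mul IHt IHu) (PA_Mul_numeral _ _ _).
Qed.

Lemma inst_up_nsub a rho phi :
  inst (numeral a) (substf (up (nsub rho)) phi) = substf (nsub (consn a rho)) phi.
Proof. by rewrite inst_substf; apply: substf_ext => -[]. Qed.

(** [P] and [Q] stand for two alternatives that each carry evidence, such as provable and refutable.
    Exchanging them turns the search for a counterexample into the search for a witness. *)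
Lemma bounded_dec (P Q : nat -> Prop) m :
  (forall k, P k \/ Q k) ->
  (forall k, k <= m -> P k) \/ (exists2 k, k <= m & Q k).
Proof.
move=> dec; elim: m => [|m [IH|[k lekm Qk]]].
- have [P0|Q0] := dec 0; last by right; exists 0.
  by left=> k; rewrite leqn0 => /eqP ->.
- have [Pm|Qm] := dec m.+1; last by right; exists m.+1.
  by left=> k; rewrite leq_eqVlt => /orP[/eqP -> //|/IH].
- by right; exists k => //; apply: leqW.
Qed.

Lemma PA_Le_evalt G rho t k :
  k <= evalt rho t -> prv PA G (Le (numeral k) (substt (nsub rho) t)).
Proof.
move=> le_k; apply: prv_Eq_Le (prv_EqI _ _ _) _ (PA_Le_numeral G le_k).
exact: prv_Eq_sym (PA_evalt _ _ _).
Qed.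

(** The bound evaluates to a numeral, so the variable equals one of finitely many numerals, and
    Leibniz's rule carries the numerical instance over to it. *)
Lemma PA_bounded rho t phi G :
  (forall k G', k <= evalt rho t -> prv PA G' (substf (nsub (consn k rho)) phi)) ->
  prv PA G (Le (Var 0) (shiftt (substt (nsub rho) t))) ->
  prv PA G (substf (up (nsub rho)) phi).
Proof.
move=> H D.
have : prv PA G (Le (Var 0) (numeral (evalt rho t))).
  apply: prv_Eq_Le (prv_EqI _ _ _) _ D.
  (* Index 0 does not occur in [shiftt t], so the value 0 assigned to it is arbitrary. *)
  have := PA_evalt G (consn 0 rho) (shiftt t).
  rewrite evalt_shiftt; congr (prv _ _ (Eq _ _)).
  by rewrite /shiftt !substt_comp; apply: substt_ext => i /=; rewrite substt_numeral.
move=> /PA_Le_numeralE; apply=> k lek.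
rewrite -[substf _ phi]inst_Var0_up.
apply: prv_EqE (prv_Eq_sym (prv_hyp0 _ _ _)) _.
have := H k (Eq (Var 0) (numeral k) :: G) lek; congr (prv _ _ _).
rewrite inst_substf substf_comp; apply: substf_ext => -[|i] //=.
by rewrite substt_scons_shiftt substt_numeral.
Qed.

(** Both alternatives go through one induction because implication exchanges them. Truth is decided
    along the way, so the argument stays constructive. *)
Lemma Delta0_complete phi rho :
  Delta0 phi ->
  (evalf rho phi /\ forall G, prv PA G (substf (nsub rho) phi)) \/
  (~ evalf rho phi /\ forall G, prv PA G (Neg (substf (nsub rho) phi))).
Proof.
move=> D; elim: D rho => {phi} /= [t u|t u||p q _ IHp _ IHq|p q _ IHp _ IHq
  |p q _ IHp _ IHq|t p _ IH|t p _ IH] rho.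
- have [E|/eqP neq] := eqVneq (evalt rho t) (evalt rho u); [left|right]; split=> // G.
    apply: prv_Eq_trans (PA_evalt _ _ _) _; rewrite E.
    exact: prv_Eq_sym (PA_evalt _ _ _).
  apply: prv_ImpI; apply: PA_numeral_neq (introN eqP neq) _.
  apply: prv_Eq_trans (prv_Eq_sym (PA_evalt _ _ _)) _.
  exact: prv_Eq_trans (prv_hyp0 _ _ _) (PA_evalt _ _ _).
- have [le_tu|lt_ut] := leqP (evalt rho t) (evalt rho u); [left|right]; split=> // G.
    apply: prv_Eq_Le (PA_Le_numeral G le_tu); apply: prv_Eq_sym; exact: PA_evalt.
  apply: prv_ImpI.
  have := prv_Eq_Le (PA_evalt _ _ _) (PA_evalt _ _ _)
    (prv_hyp0 PA G (Le (substt (nsub rho) t) (substt (nsub rho) u))).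
  move=> /PA_Le_numeralE; apply=> k le_ku.
  have neq : evalt rho t != k by apply: contraTneq lt_ut => ->; rewrite -leqNgt.
  exact: PA_numeral_neq neq (prv_hyp0 _ _ _).
- by right; split=> // G; apply: prv_ImpI; apply: prv_hyp0.
- have [[eq Dq]|[neq Dq]] := IHq rho.
    by left; split=> // G; apply: prv_ImpI.
  have [[ep Dp]|[nep Dp]] := IHp rho.
    right; split=> [/(_ ep)//|G]; apply: prv_ImpI.
    by apply: prv_ImpE (Dq _) _; apply: prv_ImpE (prv_hyp0 _ _ _) _.
  left; split=> // G; apply: prv_ImpI; apply: prv_BotE.
  exact: prv_ImpE (Dp _) (prv_hyp0 _ _ _).
- have [[ep Dp]|[nep Dp]] := IHp rho; last first.
    right; split=> [[//]|G]; apply: prv_ImpI.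
    exact: prv_ImpE (Dp _) (prv_AndE1 (prv_hyp0 _ _ _)).
  have [[eq Dq]|[neq Dq]] := IHq rho; last first.
    right; split=> [[//]|G]; apply: prv_ImpI.
    exact: prv_ImpE (Dq _) (prv_AndE2 (prv_hyp0 _ _ _)).
  by left; split=> // G; apply: prv_AndI.
- have [[ep Dp]|[nep Dp]] := IHp rho.
    by left; split=> [|G]; [left | apply: prv_OrI1].
  have [[eq Dq]|[neq Dq]] := IHq rho.
    by left; split=> [|G]; [right | apply: prv_OrI2].
  right; split=> [[//|//]|G]; apply: prv_ImpI.
  apply: prv_OrE (prv_hyp0 _ _ _) _ _.
    exact: prv_ImpE (Dp _) (prv_hyp0 _ _ _).
  exact: prv_ImpE (Dq _) (prv_hyp0 _ _ _).
- have [H|[k lek [nek Dk]]] := bounded_dec (evalt rho t) (fun k => IH (consn k rho)).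
    left; split=> [a|G]; first by rewrite evalt_shiftt => /H[].
    apply: prv_AllI; apply: prv_ImpI; rewrite up_shiftt.
    by apply: PA_bounded (prv_hyp0 _ _ _) => k G' /H[].
  right; split=> [/(_ k)|G]; first by rewrite evalt_shiftt => /(_ lek).
  apply: prv_ImpI; apply: prv_ImpE (Dk _) _.
  have := prv_AllE (numeral k) (prv_hyp0 PA G
    (All (Imp (Le (Var 0) (substt (up (nsub rho)) (shiftt t)))
              (substf (up (nsub rho)) p)))).
  rewrite /inst /= -/(inst _ _) inst_up_nsub up_shiftt substt_scons_shiftt substt_id.
  by move=> /prv_ImpE; apply; apply: PA_Le_evalt.
(* Alternatives exchanged: either all instances up to the bound are refutable, or one of them is
   true and provable. *)
- have [H|[k lek [ek Dk]]] := bounded_dec (evalt rho t)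
    (fun k => proj1 (or_comm _ _) (IH (consn k rho))).
    right; split=> [[a]|G]; first by rewrite evalt_shiftt => -[/H[]].
    apply: prv_ImpI; apply: prv_ExE (prv_hyp0 _ _ _) _; rewrite up_shiftt.
    apply: prv_ImpE (prv_AndE2 (prv_hyp0 _ _ _)).
    apply: (@PA_bounded rho t (Neg p)) (prv_AndE1 (prv_hyp0 _ _ _)).
    by move=> k G' /H[].
  left; split=> [|G]; first by exists k; rewrite evalt_shiftt.
  apply: (prv_ExI (t := numeral k)).
  rewrite /inst /= -/(inst _ _) inst_up_nsub up_shiftt substt_scons_shiftt substt_id.
  by apply: prv_AndI => //; apply: PA_Le_evalt.
Qed.

Lemma Delta0_prv phi rho G :
  Delta0 phi -> evalf rho phi -> prv PA G (substf (nsub rho) phi).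
Proof. by move=> /(@Delta0_complete _ rho) [[]|[]]. Qed.

Lemma Delta0_refute phi rho G :
  Delta0 phi -> ~ evalf rho phi -> prv PA G (Neg (substf (nsub rho) phi)).
Proof. by move=> /(@Delta0_complete _ rho) [[]|[]]. Qed.

Lemma evalf_substf k rho rho' sigma phi :
  closedf k phi -> (forall i, i < k -> evalt rho (sigma i) = rho' i) ->
  evalf rho (substf sigma phi) <-> evalf rho' phi.
Proof.
have tE j r r' s t : closedt j t -> (forall i, i < j -> evalt r (s i) = r' i) ->
    evalt r (substt s t) = evalt r' t.
  move=> + E; elim: t => //= [t IH /IH-> //|t IHt u IHu|t IHt u IHu];
    by case/andP=> /IHt-> /IHu->.
have upE a j r r' s : (forall i, i < j -> evalt r (s i) = r' i) ->
    forall i, i < j.+1 -> evalt (consn a r) (up s i) = consn a r' i.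
  by move=> E [|i] //=; rewrite ltnS evalt_shiftt => /E.
elim: phi k rho rho' sigma => //=.
- by move=> t u k r r' s /andP[ct cu] E; rewrite !(tE _ _ _ _ _ _ E).
- by move=> t u k r r' s /andP[ct cu] E; rewrite !(tE _ _ _ _ _ _ E).
- move=> p IHp q IHq k r r' s /andP[/IHp H1 /IHq H2] E.
  by move: (H1 _ _ _ E) (H2 _ _ _ E) => -> ->.
- move=> p IHp q IHq k r r' s /andP[/IHp H1 /IHq H2] E.
  by move: (H1 _ _ _ E) (H2 _ _ _ E) => -> ->.
- move=> p IHp q IHq k r r' s /andP[/IHp H1 /IHq H2] E.
  by move: (H1 _ _ _ E) (H2 _ _ _ E) => -> ->.
- by move=> p IHp k r r' s /IHp H E; split=> Ha a;
    move: (Ha a) (H _ _ _ (upE a _ _ _ _ E)) => + [H1 H2]; auto.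
- by move=> p IHp k r r' s /IHp H E; split=> -[a Ha]; exists a;
    move: Ha (H _ _ _ (upE a _ _ _ _ E)) => + [H1 H2]; auto.
Qed.

(** * Sequence coding *)

(** The last congruence is adjoined modulo the product of the earlier moduli; this product is
    coprime to [m n], and each earlier modulus divides it. *)
Lemma chinese_seq (m s : nat -> nat) n :
  (forall i j, i < j < n -> coprime (m i) (m j)) ->
  exists a, forall i, i < n -> a = s i %[mod m i].
Proof.
elim: n => [|n IH] co; first by exists 0.
have [|a Ha] := IH; first by move=> i j /andP[ij jn]; apply: co; lia.
have coP : coprime (\prod_(i < n) m i) (m n).
  apply: (big_ind (fun x => coprime x (m n))) => [|x y|i _].
  - exact: coprime1n.
  - by rewrite coprimeMl => -> ->.
  - by apply: co; rewrite ltn_ord /=.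
exists (chinese (\prod_(i < n) m i) (m n) a (s n)) => i.
rewrite ltnS leq_eqVlt => /orP[/eqP ->|lt_in]; first exact: chinese_modr.
rewrite -(Ha i lt_in).
have dv : m i %| \prod_(i < n) m i by rewrite (bigD1 (Ordinal lt_in)) //= dvdn_mulr.
by rewrite -(modn_dvdm _ dv) chinese_modl // modn_dvdm.
Qed.

Definition beta (a b i : nat) : nat := a %% (b * i.+1).+1.

(** With [b = M!], two moduli differ by [b * (j - i)]. Each is coprime to [b], and [j - i] divides
    [b], so they are coprime to each other. Since [s i <= M <= M!], every entry is below its modulus
    and is its own residue. *)
Lemma beta_seq (s : nat -> nat) n :
  exists a b, forall i, i < n -> beta a b i = s i.
Proof.
pose M := n + \max_(i < n) s i; pose b := M`!.
have [|a Ha] := @chinese_seq (fun i => (b * i.+1).+1) s n.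
  move=> i j /andP[lt_ij lt_jn].
  have co : coprime (b * i.+1).+1 b.
    by rewrite -addn1 -coprime_modl mulnC modnMDl coprime_modl coprime1n.
  have -> : (b * j.+1).+1 = (b * i.+1).+1 + b * (j - i).
    by rewrite addSn -mulnDr addSn subnKC // ltnW.
  rewrite /coprime gcdnDl -/(coprime _ _) coprimeMr co.
  by apply: coprime_dvdr co; apply: dvdn_fact; lia.
exists a, b => i lt_in; rewrite /beta Ha //; apply: modn_small.
have le_sM : s i <= M.
  by rewrite /M; apply: leq_trans (leq_addl _ _); apply: (leq_bigmax (Ordinal lt_in)).
rewrite ltnS; apply: leq_trans le_sM _; apply: leq_trans (fact_geq M) _.
exact: leq_pmulr.
Qed.

(** * Representing functions by Delta0 formulas *)

(* If [phi(x,y,z)] (indices 2, 1, 0) says that [z] witnesses [f(x) = y], this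
   strengthens [phi] so that uniqueness of [y] becomes provable for each numeral
   [x]: no witness up to [z] yields another value. *)
Definition uniq_wit (phi : form) : form :=
  And (Le (Var 1) (Var 0)) (And phi
    (All (Imp (Le (Var 0) (Var 1))
      (All (Imp (Le (Var 0) (Var 1))
        (Imp (substf (scons (Var 1) (scons (Var 0) (scons (Var 4) Var))) phi)
             (Eq (Var 0) (Var 3)))))))).

Lemma Delta0_uniq_wit phi : Delta0 phi -> Delta0 (uniq_wit phi).
Proof.
move=> D; apply: Delta0_And; [exact: Delta0_Le | apply: Delta0_And => //].
apply: (Delta0_All (Var 0)); apply: (Delta0_All (Var 0)).
by apply: Delta0_Imp; [apply: Delta0_substf | apply: Delta0_Eq].
Qed.

Lemma closedf_uniq_wit phi : closedf 3 phi -> closedf 3 (uniq_wit phi).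
Proof.
move=> c; rewrite /uniq_wit /= c /= andbT.
by apply: closedf_substf c _ => -[|[|[|]]].
Qed.

Definition env3 (z y x : nat) : nat -> nat := consn z (consn y (consn x (fun=> 0))).

Definition sub3 (z y x : term) : nat -> term := scons z (scons y (scons x Var)).

Section UniqWit.

Variables (phi : form) (d m k : nat).
Hypotheses (Dphi : Delta0 phi) (cphi : closedf 3 phi).
Hypothesis phi_fun : forall y z, evalf (env3 z y d) phi -> y = m.
Hypotheses (phi_k : evalf (env3 k m d) phi) (le_mk : m <= k).

Let sub3_nsub z y psi : closedf 3 psi ->
  substf (sub3 (numeral z) (numeral y) (numeral d)) psi =
  substf (nsub (env3 z y d)) psi.
Proof. by move=> c; apply: substf_closed c _ => -[|[|[|]]]. Qed.

Lemma uniq_wit_prv G :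
  prv PA G (substf (sub3 (numeral k) (numeral m) (numeral d)) (uniq_wit phi)).
Proof.
rewrite sub3_nsub ?closedf_uniq_wit //; apply: Delta0_prv.
  exact: Delta0_uniq_wit.
split=> //; split=> // z /= _ y _.
have E : forall i, i < 3 -> evalt (consn y (consn z (env3 k m d)))
    (scons (Var 1) (scons (Var 0) (scons (Var 4) Var)) i) = env3 z y d i.
  by move=> -[|[|[|]]].
by move=> /(evalf_substf cphi E) /phi_fun.
Qed.

(** Rosser's comparison: the witness [t] is compared inside PA with the standard witness [k]. *)
Lemma uniq_wit_eq G t s :
  prv PA G (substf (sub3 t s (numeral d)) (uniq_wit phi)) ->
  prv PA G (Eq s (numeral m)).
Proof.
rewrite /uniq_wit /= => D.
have Dst := prv_AndE1 D; have Dphi1 := prv_AndE1 (prv_AndE2 D).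
have Dall := prv_AndE2 (prv_AndE2 D).
apply: prv_OrE (prv_AllE t (prv0_weak _ (PA_Le_total_numeral k))) _ _.
  rewrite substt_numeral.
  (* If [k <= t], the uniqueness clause at [t] applies to the rival pair of witness [k] and value
     [m]; [m <= k] puts [m] within its range. *)
  move/(prv_AllE (numeral k))/(prv_hypS (Le (numeral k) t)): Dall.
  rewrite /inst /= !substt_scons_shiftt !substt_id.
  move=> /prv_ImpE /(_ (prv_hyp0 _ _ _)).
  move/(prv_AllE (numeral m)).
  rewrite /inst /= substt_scons_shiftt substt_id.
  move=> /prv_ImpE /(_ (PA_Le_numeral _ le_mk)).
  rewrite !substf_comp => D1; apply: prv_Eq_sym.
  have := prv_ImpE D1; rewrite {2}/shiftt !substt_comp /= substt_id; apply.
  have := Delta0_prv (Le (numeral k) t :: G) Dphi phi_k; congr (prv _ _ _).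
  apply: substf_closed cphi _ => -[|[|[|]]] //= _;
    by rewrite ?shiftt_numeral ?substt_numeral.
rewrite /= ?substt_numeral.
(* If [t <= k], then [t] is a numeral [j], and [s <= t] makes [s] a numeral [i]. For [i] other than
   [m], the instance of [phi] is false, hence refutable. *)
apply: PA_Le_numeralE (prv_hyp0 _ _ _) _ => j lejk.
set G' := (_ :: _).
have Dtj : prv PA G' (Eq t (numeral j)) by apply: prv_hyp0.
have : prv PA G' (Le s (numeral j)).
  by apply: prv_Eq_Le (prv_EqI _ _ _) Dtj _; do 2!apply: prv_hypS.
move=> /PA_Le_numeralE; apply=> i leij.
have [->|neq] := eqVneq i m; first exact: prv_hyp0.
set G'' := (_ :: _).
apply: prv_BotE; apply: prv_ImpE.
  apply: (@Delta0_refute phi (env3 j i d)) => // /phi_fun /eqP; exact: negP.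
rewrite -sub3_nsub //.
have Dj : prv PA G'' (substf (sub3 (numeral j) s (numeral d)) phi).
  rewrite /sub3 -inst_substf; apply: prv_EqE (prv_hypS _ Dtj) _.
  by rewrite inst_substf; do 3!apply: prv_hypS.
have E u : inst u (substf (scons (numeral j) (up (scons (numeral d) Var))) phi)
    = substf (sub3 (numeral j) u (numeral d)) phi.
  rewrite /inst substf_comp; apply: substf_closed cphi _.
  by move=> [|[|[|]]] //= _; rewrite ?substt_scons_shiftt substt_numeral.
by rewrite -E; apply: prv_EqE (prv_hyp0 _ _ _) _; rewrite E.
Qed.

End UniqWit.

(** Division with remainder. The quotient is bounded by [a], which keeps the formula Delta0, and [m]
    is one less than the modulus. *)
Definition beta_form (a b i u : term) : form :=
  let m := Mul (shiftt b) (Succ (shiftt i)) in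
  Ex (And (Le (Var 0) (shiftt a))
     (And (Eq (shiftt a) (Add (Mul (Var 0) (Succ m)) (shiftt u)))
          (Le (shiftt u) m))).

Lemma Delta0_beta_form a b i u : Delta0 (beta_form a b i u).
Proof.
apply: Delta0_Ex; apply: Delta0_And; [exact: Delta0_Eq | exact: Delta0_Le].
Qed.

Lemma closedt_shiftt k t : closedt k t -> closedt k.+1 (shiftt t).
Proof. by move=> c; apply: closedt_substt c _. Qed.

Lemma evalf_beta_form rho a b i u :
  evalf rho (beta_form a b i u) <->
  beta (evalt rho a) (evalt rho b) (evalt rho i) = evalt rho u.
Proof.
rewrite /beta_form /=; split=> [[q]|E].
  rewrite !evalt_shiftt /beta => -[_ [-> leu]].
  by rewrite modnMDl modn_small.
exists (evalt rho a %/ (evalt rho b * (evalt rho i).+1).+1).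
rewrite !evalt_shiftt; split; first exact: leq_div.
rewrite -E /beta; split; first exact: divn_eq.
by rewrite -ltnS ltn_pmod.
Qed.

(** Pairing is a polynomial, so syntactic operations such as negation act on codes through terms of
    the language. *)
Definition opairt (t u : term) : term :=
  Succ (Add (Mul (Add t u) (Add t u)) t).

Lemma evalt_opairt rho t u :
  evalt rho (opairt t u) = opair (evalt rho t) (evalt rho u).
Proof. by []. Qed.

(* Indices 2, 1, 0 are [x], [y], [z]: some [a], [b], [v <= z] are such that
   [beta a b] lists the Goedel numbers of the numerals up to [x], [v] is the last
   of them, and [y] is the value of [q] at [v] (index 0) and [x] (index 1). *)
Definition gnum_graph (q : term) : form :=
  Ex (And (Le (Var 0) (Var 1))
  (Ex (And (Le (Var 0) (Var 2))
  (Ex (And (Le (Var 0) (Var 3))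
    (And (beta_form (Var 2) (Var 1) Zero (numeral (gnt Zero)))
    (And (All (Imp (Le (Var 0) (Var 6))
           (Or (Eq (Var 0) (Var 6))
               (Ex (And (Le (Var 0) (Var 4))
                 (And (beta_form (Var 4) (Var 3) (Var 1) (Var 0))
                      (beta_form (Var 4) (Var 3) (Succ (Var 1))
                                 (opairt (numeral 2) (Var 0)))))))))
    (And (beta_form (Var 2) (Var 1) (Var 5) (Var 0))
         (Eq (Var 4) (substt (scons (Var 0) (scons (Var 5) Var)) q)))))))))).

Lemma Delta0_gnum_graph q : Delta0 (gnum_graph q).
Proof.
apply: (Delta0_Ex (Var 0)); apply: (Delta0_Ex (Var 1)); apply: (Delta0_Ex (Var 2)).
apply: Delta0_And; first exact: Delta0_beta_form.
apply: Delta0_And; last first.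
  by apply: Delta0_And; [apply: Delta0_beta_form | apply: Delta0_Eq].
apply: (Delta0_All (Var 5)); apply: Delta0_Or; first exact: Delta0_Eq.
apply: (Delta0_Ex (Var 3)).
by apply: Delta0_And; apply: Delta0_beta_form.
Qed.

Lemma closedf_gnum_graph q : closedt 2 q -> closedf 3 (gnum_graph q).
Proof.
move=> c.
have cq : closedt 6 (substt (scons (Var 0) (scons (Var 5) Var)) q).
  by apply: closedt_substt c _ => -[|[]].
by rewrite /gnum_graph /= ?closedt_numeral ?cq ?closedt_shiftt ?closedt_numeral.
Qed.

Lemma evalt_closed k rho rho' t :
  closedt k t -> (forall i, i < k -> rho i = rho' i) -> evalt rho t = evalt rho' t.
Proof.
move=> + E; elim: t => //= [t IH /IH-> //|t IHt u IHu|t IHt u IHu];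
  by case/andP=> /IHt-> /IHu->.
Qed.

Definition eval2 (q : term) (v x : nat) : nat :=
  evalt (consn v (consn x (fun=> 0))) q.

(** The induction along the coded list takes place in the standard model; [uniq_wit] turns this into
    provable uniqueness. *)
Lemma gnum_graph_fun q d y z :
  closedt 2 q -> evalf (env3 z y d) (gnum_graph q) ->
  y = eval2 q (gnt (numeral d)) d.
Proof.
move=> cq [a [_ [b [_ [v [_ [H0 [HS [Hv Hy]]]]]]]]].
move/evalf_beta_form: H0; rewrite evalt_numeral /= => H0.
move/evalf_beta_form: Hv => /= Hv.
have Hi i : i <= d -> beta a b i = gnt (numeral i).
  elim: i => [|i IH] lt_id //=.
  have [|/= E|[u [_ [/evalf_beta_form E1 /evalf_beta_form E2]]]] := HS i.
  - exact: ltnW.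
  - by rewrite E ltnn in lt_id.
  - move: E1 E2; rewrite evalt_opairt evalt_numeral /= => E1 ->.
    by rewrite -E1 IH // ltnW.
move: Hy; rewrite -(Hi d (leqnn d)) Hv /= evalt_substt => ->.
by apply: evalt_closed cq _ => -[|[]].
Qed.

Lemma gnum_graph_ex q d :
  closedt 2 q ->
  let m := eval2 q (gnt (numeral d)) d in
  exists2 k, m <= k & evalf (env3 k m d) (gnum_graph q).
Proof.
move=> cq m; have [a [b Hab]] := beta_seq (fun i => gnt (numeral i)) d.+1.
have lea i : beta a b i <= a by apply: leq_mod.
(* This bounds [m], [a], [b] and also the last entry, which is a residue of [a]. *)
exists (a + b + m); first exact: leq_addl.
exists a; split; first by rewrite /=; lia.
exists b; split; first by rewrite /=; lia.
exists (gnt (numeral d)); split; first by rewrite -Hab //=; have := lea d; lia.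
split; first by apply/evalf_beta_form; rewrite evalt_numeral Hab.
split; last first.
  split; first by apply/evalf_beta_form; rewrite /= Hab.
  rewrite /= evalt_substt /m /eval2.
  by apply: evalt_closed cq _ => -[|[]].
(* The disjunct [i = x] of the formula exempts the last entry, which has no successor in the
   list. *)
move=> i le_id; have [->|neq] := eqVneq i d; [by left | right].
have lt_id : i < d by rewrite ltn_neqAle neq.
exists (beta a b i); split; first exact: lea.
split; first exact/evalf_beta_form.
by apply/evalf_beta_form; rewrite evalt_opairt evalt_numeral /= !Hab // ltnS ltnW.
Qed.

(** * The diagonal lemma *)

Lemma prv_ExI3 T G phi t s u :
  prv T G (substf (sub3 t s u) phi) -> prv T G (Ex (Ex (Ex phi))).
Proof.
move=> D; apply: (prv_ExI (t := u)); rewrite /inst /=.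
apply: (prv_ExI (t := s)); rewrite /inst /=.
apply: (prv_ExI (t := t)); move: D; rewrite /inst !substf_comp.
congr (prv _ _ _); apply: substf_ext => -[|[|[|i]]] //=.
- by rewrite substt_scons_shiftt substt_id.
- by rewrite /shiftt !substt_comp substt_id.
Qed.

(* The value at [v = gnt (numeral d)], [x = gn alpha] is the Goedel number of the
   diagonal sentence in [Sigma1_diagonal]. *)
Definition diag_term (n : nat) : term :=
  iter n.+3 (opairt (numeral 12)) (opairt (numeral 9)
    (opairt (opairt (numeral 5) (opairt (numeral (gnt (Var n.+2))) (Var 0)))
            (Var 1))).

Lemma closedt_opairt k t u : closedt k (opairt t u) = closedt k t && closedt k u.
Proof. by rewrite /=; case: (closedt k t); case: (closedt k u). Qed.

Lemma closedt_diag_term n : closedt 2 (diag_term n).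
Proof.
rewrite /diag_term; elim: n.+3 => [|k IH].
  by rewrite /= !closedt_numeral.
by rewrite iterS closedt_opairt closedt_numeral.
Qed.

Lemma eval2_diag_term n d alpha :
  d = gn alpha ->
  eval2 (diag_term n) (gnt (numeral d)) d =
  gn (iter n.+3 Ex (And (Eq (Var n.+2) (numeral d)) alpha)).
Proof.
move=> Ed; rewrite /eval2 /diag_term; elim: n.+3 => [|k IH].
  by rewrite !evalt_opairt !evalt_numeral /= -Ed.
by rewrite !iterS evalt_opairt IH evalt_numeral.
Qed.

Lemma iter_shiftf_Eq n i d :
  iter n shiftf (Eq (Var i) (numeral d)) = Eq (Var (n + i)) (numeral d).
Proof. by elim: n => //= n ->; rewrite /shiftf /= substt_numeral. Qed.

Lemma Delta0_iter_shiftf n phi : Delta0 phi -> Delta0 (iter n shiftf phi).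
Proof. by move=> D; elim: n => //= n; apply: Delta0_substf. Qed.

(** For [x = d], the conjunct [D1] forces [y] to be the value of [q] at the code of the numeral [d]
    and at [d], which is the code of [theta]. Since [q] depends only on [n], [alpha] is complete
    before its code [d] is taken. *)
Theorem Sigma1_diagonal phi :
  Sigma1 phi -> closedf 1 phi ->
  exists theta, [/\ sentence theta, Sigma1 theta &
    provable PA (Iff theta (inst (quote theta) phi))].
Proof.
move=> [n [delta [Ddelta Ephi]]] cphi.
pose q := diag_term n; pose D1 := uniq_wit (gnum_graph q).
have cq := closedt_diag_term n.
have cG := closedf_gnum_graph cq; have DG := Delta0_gnum_graph q.
have cD1 : closedf 3 D1 by apply: closedf_uniq_wit.
have DD1 : Delta0 D1 by apply: Delta0_uniq_wit.
(* The shift moves the free variable of [phi] to index 1, the place of [y] in the block [x], [y],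
   [z]. *)
pose delta' := substf (iter n up (fun i => Var i.+1)) delta.
have Ephi' : shiftf phi = iter n Ex delta' by rewrite Ephi /shiftf substf_iter_Ex.
pose alpha := And (iter n shiftf D1) delta'.
(* [d] is kept abstract so that its numeral is never unfolded. *)
have [d Ed] : exists d, d = gn alpha by exists (gn alpha).
pose theta := iter n.+3 Ex (And (Eq (Var n.+2) (numeral d)) alpha).
pose m := gn theta.
have Em : eval2 q (gnt (numeral d)) d = m by apply: eval2_diag_term.
have [k lemk Gk] := gnum_graph_ex d cq; rewrite -/q Em in lemk Gk.
have Gfun y z : evalf (env3 z y d) (gnum_graph q) -> y = m.
  by rewrite -Em; apply: gnum_graph_fun.
have EEq : Eq (Var n.+2) (numeral d) = iter n shiftf (Eq (Var 2) (numeral d)).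
  by rewrite iter_shiftf_Eq addn2.
have sent_m : sentence (inst (numeral m) phi).
  by apply: closedf_substf cphi _ => -[|//] _; apply: closedt_numeral.
exists theta; split.
- rewrite /sentence /theta closedf_iter_Ex addn0 /= closedt_numeral andbT.
  apply/and3P; split; first lia.
    by rewrite -[n.+3]addn3; apply: closedf_iter_shiftf.
  have : closedf 3 (shiftf phi) by apply: closedf_substf cphi _ => -[].
  by rewrite Ephi' closedf_iter_Ex addn3.
- exists n.+3, (And (Eq (Var n.+2) (numeral d)) alpha); split=> //.
  apply: Delta0_And; first exact: Delta0_Eq.
  by apply: Delta0_And; [apply: Delta0_iter_shiftf | apply: Delta0_substf].
rewrite /quote -/m; apply: prv_AndI; apply: prv_ImpI.
(* From [theta] to [phi]: open [x], [y], [z] and pull [x = d] and [D1] out of the inner block;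
   uniqueness then gives [y = m]. *)
- apply: prv_ExE (prv_hyp0 _ _ _) _; apply: prv_ExE (prv_hyp0 _ _ _) _.
  apply: prv_ExE (prv_hyp0 _ _ _) _; rewrite /shiftf !(substf_sentence _ sent_m).
  set G := (X in prv PA X); rewrite -/G.
  have : prv PA G (iter n Ex (And (Eq (Var n.+2) (numeral d)) alpha)).
    exact: prv_hyp0.
  rewrite EEq => /prv_iter_Ex_And D.
  have Dd := prv_AndE1 D; have /prv_iter_Ex_And := prv_AndE2 D.
  rewrite -Ephi' => DD; have DB := prv_AndE2 DD.
  (* Reindexed so that [x] becomes index 0, where Leibniz's rule can replace it by [d]. *)
  have E u : inst u (substf (scons (Var 1) (scons (Var 2) (scons (Var 0) Var))) D1)
      = substf (sub3 (Var 0) (Var 1) u) D1.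
    by rewrite /inst substf_comp; apply: substf_closed cD1 _ => -[|[|[|]]].
  have D1d : prv PA G (substf (sub3 (Var 0) (Var 1) (numeral d)) D1).
    rewrite -E; apply: prv_EqE Dd _; rewrite E.
    have := prv_AndE1 DD; congr (prv _ _ _).
    by rewrite -[LHS]substf_id; apply: substf_closed cD1 _ => -[|[|[|]]].
  have Dm := uniq_wit_eq DG cG Gfun Gk lemk D1d.
  apply: prv_EqE Dm _; move: DB; congr (prv _ _ _).
  by apply: substf_closed cphi _ => -[].
- set G := [:: _].
  (* From [phi] to [theta]: the witnesses are [x = d], [y = m], [z = k]. The two conjuncts outside
     [phi] are then pushed into its quantifier block. *)
  have : prv PA G (Ex (Ex (Ex (And (Eq (Var 2) (numeral d)) (And D1 (shiftf phi)))))).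
    apply: (@prv_ExI3 _ _ _ (numeral k) (numeral m) (numeral d)).
    rewrite /= substt_numeral; apply: prv_AndI; first exact: prv_EqI.
    apply: prv_AndI; first exact: (uniq_wit_prv DG cG Gfun Gk lemk).
    have := prv_hyp0 PA [::] (inst (numeral m) phi); congr (prv _ _ _).
    by rewrite /shiftf substf_comp; apply: substf_closed cphi _ => -[].
  move=> D; apply: (prv_Ex_mono D); apply: (prv_Ex_mono (prv_hyp0 _ _ _)).
  apply: (prv_Ex_mono (prv_hyp0 _ _ _)).
  set G' := (_ :: _); have H : prv PA G' _ := prv_hyp0 _ _ _.
  apply: prv_cut (prv_AndE1 H) _; rewrite EEq.
  apply: prv_And_iter_Ex; first by left.
  apply: prv_cut (prv_hypS _ (prv_AndE1 (prv_AndE2 H))) _.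
  apply: prv_And_iter_Ex; first by left.
  by rewrite -Ephi'; do 2!apply: prv_hypS; apply: prv_AndE2 (prv_AndE2 H).
Qed.

(** [F] acts on codes as the term [t], so the diagonal lemma is applied to [Pr] at [t]; evaluating
    [t] at the numeral of [theta] gives the quotation of [F theta]. *)
Lemma Sigma1_fixpoint Pr F t :
  Sigma1 Pr -> closedf 1 Pr -> closedt 1 t ->
  (forall phi rho, rho 0 = gn phi -> evalt rho t = gn (F phi)) ->
  exists theta, [/\ sentence theta, Sigma1 theta &
    provable PA (Iff theta (inst (quote (F theta)) Pr))].
Proof.
move=> SPr cPr ct HF; pose B := substf (scons t Var) Pr.
have cB : closedf 1 B by apply: closedf_substf cPr _ => -[].
have [theta [st S1 D]] := Sigma1_diagonal (Sigma1_substf _ SPr : Sigma1 B) cB.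
exists theta; split=> //.
pose rho (i : nat) := gn theta.
have EB : inst (quote theta) B = inst (substt (nsub rho) t) Pr.
  rewrite /inst substf_comp; apply: substf_closed cPr _ => -[|//] _ /=.
  by apply: substt_closed ct _ => -[].
have Et G : prv PA G (Eq (substt (nsub rho) t) (quote (F theta))).
  by rewrite /quote -(HF theta rho) //; apply: PA_evalt.
rewrite EB in D; apply: prv_AndI; apply: prv_ImpI.
  apply: prv_EqE (Et _) _.
  exact: prv_ImpE (prv_hypS _ (prv_AndE1 D)) (prv_hyp0 _ _ _).
apply: prv_ImpE (prv_hypS _ (prv_AndE2 D)) _.
exact: prv_EqE (prv_Eq_sym (Et _)) (prv_hyp0 _ _ _).
Qed.

(** * Refuting the consistency schema *)

Lemma bigAnd_prv T s :
  (forall psi, psi \in s -> provable T psi) -> provable T (bigAnd s).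
Proof.
elim: s => [|p [|q s] IH] H; first exact: prv_EqI.
  by apply: H; rewrite inE.
apply: prv_AndI; first by apply: H; rewrite inE eqxx.
by apply: IH => r rs; apply: H; rewrite inE rs orbT.
Qed.

Definition Negt (t : term) : term :=
  opairt (numeral 8) (opairt t (numeral (gn Bot))).

Lemma evalt_Negt rho t phi :
  evalt rho t = gn phi -> evalt rho (Negt t) = gn (Neg phi).
Proof. by move=> E; rewrite /Negt !evalt_opairt !evalt_numeral E. Qed.

Theorem theorem2p8 (S T : theory) (Pr : form)
  (ceS : ce_theory S) (ceT : ce_theory T)
  (conS : consistent S) (conT : consistent T)
  (extS : stronger S PA) (extT : stronger T PA)
  (strST : stronger T S)
  (Pr_Sigma1 : Sigma1 Pr) (Pr_pred : provability_predicate S T Pr) :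
  (cond_E S T Pr -> cond_D3 S Pr ->
     exists chi, Con_S Pr chi /\ ~ provable T chi) /\
  (cond_Sigma1C_minus S T Pr ->
     exists chi, Con_S Pr chi /\ ~ provable T chi).
Proof.
have [cPr PrP] := Pr_pred.
(* The contradiction shared by both parts; the last premise passes from a refutation of [theta] to
   one of [psi]. *)
have key theta psi :
    provable T (Iff theta (inst (quote (Neg psi)) Pr)) ->
    provable T (Imp (inst (quote (Neg psi)) Pr) (inst (quote psi) Pr)) ->
    prv T [:: Neg theta] (Neg psi) ->
    exists chi, Con_S Pr chi /\ ~ provable T chi.
  move=> Dfix Dpos Dneg.
  exists (Imp (inst (quote psi) Pr) (Neg (inst (quote (Neg psi)) Pr))).
  split; first by exists psi.
  move=> Dcon.
  have Dnth : provable T (Neg theta).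
    apply: prv_ImpI.
    have DP := prv_ImpE (prv_hypS theta (prv_AndE1 Dfix)) (prv_hyp0 _ _ _).
    apply: (prv_ImpE _ DP); apply: prv_ImpE (prv_hypS _ Dcon) _.
    exact: prv_ImpE (prv_hypS _ Dpos) DP.
  have Dnpsi : provable T (Neg psi) by apply: prv_cut Dnth Dneg.
  apply: conT; apply: prv_ImpE Dnth _; apply: prv_ImpE (prv_AndE2 Dfix) _.
  exact/strST/PrP.
split=> [E D3|[T0 [_ T0P S1C]]].
- have [|phi rho E0|theta [_ _ D]] :=
      @Sigma1_fixpoint Pr Neg (Negt (Var 0)) Pr_Sigma1 cPr.
  + by rewrite !closedt_opairt !closedt_numeral.
  + exact: evalt_Negt.
  apply: (key theta theta); [exact: extT | apply: strST | exact: prv_hyp0].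
  (* D3 gives [Pr(Pr(~theta))] from [Pr(~theta)], and E along the fixed point turns it into
     [Pr(theta)]. *)
  apply: prv_ImpI; apply: prv_ImpE (prv_hypS _ (prv_AndE2 (E _ _ (extT _ D)))) _.
  exact: prv_ImpE (prv_hypS _ (D3 _)) (prv_hyp0 _ _ _).
- pose F phi := Neg (Imp (bigAnd T0) phi).
  pose t := opairt (numeral 8) (opairt (numeral (gn (bigAnd T0))) (Var 0)).
  have [|phi rho E0|theta [sth S1th D]] :=
      @Sigma1_fixpoint Pr F (Negt t) Pr_Sigma1 cPr.
  + by rewrite !closedt_opairt !closedt_numeral.
  + by apply: evalt_Negt; rewrite !evalt_opairt !evalt_numeral /= E0.
  apply: (key theta (Imp (bigAnd T0) theta)); first exact: extT.
    (* In [S], [Pr(~psi)] yields the Sigma1 sentence [theta], and Sigma1 completeness yields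
       [Pr(psi)]. *)
    apply: strST; apply: prv_ImpI; apply: prv_ImpE (prv_hypS _ (S1C _ sth S1th)) _.
    exact: prv_ImpE (prv_hypS _ (prv_AndE2 (extS _ D))) (prv_hyp0 _ _ _).
  (* [T] proves the conjunction of [T0], so refuting [theta] refutes [psi]. *)
  apply: prv_ImpI; apply: prv_ImpE (prv_hypS _ (prv_hyp0 _ _ _)) _.
  apply: prv_ImpE (prv_hyp0 _ _ _) _; apply: prv0_weak.
  by apply: bigAnd_prv => psi /T0P[].
Qed.
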